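(* Let $K, M, N, d$ be positive integers, $\sigma^2>0$, $P>0$, weights $\omega_1,\ldots,\omega_K>0$, and channel matrices $\boldsymbol{H}_k\in\mathbb{C}^{N\times M}$. For $\boldsymbol{V}=(\boldsymbol{V}_1,\ldots,\boldsymbol{V}_K)$, $\boldsymbol{V}_k\in\mathbb{C}^{M\times d}$, define $$f(\boldsymbol{V})=\sum_{k=1}^K\omega_k\log\left|\boldsymbol{I}+\boldsymbol{V}_k^{\mathrm{H}}\boldsymbol{H}_k^{\mathrm{H}}\boldsymbol{F}_k^{-1}\boldsymbol{H}_k\boldsymbol{V}_k\right|,\quad \boldsymbol{F}_k=\sigma^2\boldsymbol{I}+\sum_{j\ne k}\boldsymbol{H}_k\boldsymbol{V}_j\boldsymbol{V}_j^{\mathrm{H}}\boldsymbol{H}_k^{\mathrm{H}},$$ and, for $\sum_k\|\boldsymbol{V}_k\|_F^2>0$, $$g(\boldsymbol{V})=\sum_{k=1}^K\omega_k\log\left|\boldsymbol{I}+\boldsymbol{V}_k^{\mathrm{H}}\boldsymbol{H}_k^{\mathrm{H}}\widetilde{\boldsymbol{F}}_k^{-1}\boldsymbol{H}_k\boldsymbol{V}_k\right|,\quad \widetilde{\boldsymbol{F}}_k=\Big(\frac{\sigma^2}{P}\sum_{j=1}^K\|\boldsymbol{V}_j\|_F^2\Big)\boldsymbol{I}+\sum_{j\ne k}\boldsymbol{H}_k\boldsymbol{V}_j\boldsymbol{V}_j^{\mathrm{H}}\boldsymbol{H}_k^{\mathrm{H}}.$$ Consider the unconstrained problem $\max_{\boldsymbol{V}}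 g(\boldsymbol{V})$ and the constrained problem $\max_{\boldsymbol{V}} f(\boldsymbol{V})$ subject to $\sum_{k=1}^K\|\boldsymbol{V}_k\|_F^2\le P$. Then for any $\boldsymbol{V}$ with $\sum_{k=1}^K\|\boldsymbol{V}_k\|_F^2>0$, $\boldsymbol{V}$ is a stationary point of the unconstrained problem if and only if $\rho\boldsymbol{V}$ is a stationary point of the constrained problem, where $\rho=\big(P/\sum_{k=1}^K\|\boldsymbol{V}_k\|_F^2\big)^{1/2}$.
   Context: $|\cdot|$ denotes determinant, $\|\cdot\|_F$ Frobenius norm. A stationary point of the unconstrained problem is a point where $\nabla g=\boldsymbol{0}$; a stationary point of the constrained problem is a feasible point satisfying the KKT conditions. Gradients are with respect to the complex matrices viewed as real variables. *)

(* Defs.v *)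
From HB Require Import structures.
From mathcomp Require Import all_boot all_order all_algebra.
From mathcomp Require Import all_classical all_reals all_analysis.
From mathcomp Require Import complex.
Set Implicit Arguments. Unset Strict Implicit. Unset Printing Implicit Defensive.
Import Order.TTheory GRing.Theory Num.Theory.
Local Open Scope ring_scope.

Section Defs.
Variable R : realType.
Local Notation C := (R[i]).

Definition cr (t : R) : C := Complex t 0.

Definition ctr (m n : nat) (A : 'M[C]_(m, n)) : 'M[C]_(n, m) :=
  (map_mx (@conjc R) A)^T.

Definition frob2 (m n : nat) (A : 'M[C]_(m, n)) : R :=
  \sum_(i < m) \sum_(j < n) ((complex.Re (A i j)) ^+ 2 + (complex.Im (A i j)) ^+ 2).

Definition totpow (K M d : nat) (V : 'I_K -> 'M[C]_(M, d)) : R :=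
  \sum_(k < K) frob2 (V k).

(* log |A| for a matrix with (real positive) determinant: log of the real part *)
Definition logdet (n : nat) (A : 'M[C]_n) : R := ln (complex.Re (\det A)).

Definition wsr (K M N d : nat) (w : 'I_K -> R) (H : 'I_K -> 'M[C]_(N, M))
    (s : R) (V : 'I_K -> 'M[C]_(M, d)) : R :=
  \sum_(k < K) w k * logdet
    (1%:M + ctr (V k) *m ctr (H k) *m
       invmx (cr s *: 1%:M
              + \sum_(j < K | j != k) H k *m V j *m ctr (V j) *m ctr (H k))
       *m H k *m V k).

Definition fobj (K M N d : nat) (sigma2 : R) (w : 'I_K -> R)
    (H : 'I_K -> 'M[C]_(N, M)) (V : 'I_K -> 'M[C]_(M, d)) : R :=
  wsr w H sigma2 V.

Definition gobj (K M N d : nat) (sigma2 P : R) (w : 'I_K -> R)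
    (H : 'I_K -> 'M[C]_(N, M)) (V : 'I_K -> 'M[C]_(M, d)) : R :=
  wsr w H (sigma2 / P * totpow V) V.

Definition vline (K M d : nat) (V W : 'I_K -> 'M[C]_(M, d)) (t : R) :
  'I_K -> 'M[C]_(M, d) := fun k => V k + cr t *: W k.

Definition vscale (K M d : nat) (r : R) (V : 'I_K -> 'M[C]_(M, d)) :
  'I_K -> 'M[C]_(M, d) := fun k => cr r *: V k.

(* directional derivative (real direction W in the real vector space
   (C^{M x d})^K viewed as R^{2KMd}) of h at V equals dh *)
Definition dirder (K M d : nat) (h : ('I_K -> 'M[C]_(M, d)) -> R)
    (V W : 'I_K -> 'M[C]_(M, d)) (dh : R) : Prop :=
  is_derive (0 : R) (1 : R) (fun t : R => h (vline V W t)) dh.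

(* stationary point of the unconstrained problem max h :  grad h(V) = 0,
   expressed as: every real directional derivative exists and is 0 *)
Definition stationary (K M d : nat) (h : ('I_K -> 'M[C]_(M, d)) -> R)
    (V : 'I_K -> 'M[C]_(M, d)) : Prop :=
  forall W, dirder h V W 0.

(* KKT point of  max h(V)  s.t.  c(V) <= 0 :
   feasibility, mu >= 0, grad h = mu grad c, complementary slackness *)
Definition kkt_point (K M d : nat) (h c : ('I_K -> 'M[C]_(M, d)) -> R)
    (V : 'I_K -> 'M[C]_(M, d)) : Prop :=
  c V <= 0 /\
  exists mu : R, 0 <= mu /\ mu * c V = 0 /\
    forall W, exists dh dc, dirder h V W dh /\ dirder c V W dc /\ dh = mu * dc.

Definition powcon (K M d : nat) (P : R) (V : 'I_K -> 'M[C]_(M, d)) : R :=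
  totpow V - P.

End Defs.

(* Main.v *)
(** Since the rate is invariant under (noise, beamformers) |-> (r^2 noise, r V),
    f near rho V and g near V are both read off the rate phi(s, V) at the single
    point s = sigma^2 T / P, with T the total power of V.  Writing D for the
    derivative of phi in s and l for the derivative of the total power, g is
    stationary iff  d_V phi(W) = - (sigma^2 / P) D l(W)  for all W, which is the
    KKT equation at rho V with multiplier mu = - s D / P.  The sign mu >= 0 holds
    because more noise lowers the rate; conversely the value of mu is forced by
    taking W = V, where Euler's identity reads d_V phi(V) = - 2 s D.
    Differentiability is elementary: by Sylvester's determinant identity each
    log-determinant in phi is a difference of two logarithms of determinants that
    are polynomial along lines. *)
Require Import Defs.
From HB Require Import structures.
From mathcomp Require Import all_boot all_order all_algebra.
From mathcomp Require Import all_classical all_reals all_analysis.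
From mathcomp Require Import complex.
From mathcomp Require Import ring.
Import Order.TTheory GRing.Theory Num.Theory numFieldNormedType.Exports.
Local Open Scope ring_scope.

Set Implicit Arguments. Unset Strict Implicit. Unset Printing Implicit Defensive.

(* [all_algebra] shadows the [vline] of Defs by the line spanned by a vector *)
Local Notation vline := Defs.vline.

(** * Determinants: Jacobi's formula and Sylvester's identity *)

Lemma deriv_prod (R : comNzRingType) n (F : 'I_n -> {poly R}) :
  (\prod_(k < n) F k)^`() =
  \sum_(i < n) \prod_(k < n) (if k == i then (F k)^`() else F k).
Proof.
elim: n F => [|n IHn] F; first by rewrite !big_ord0 derivC.
rewrite big_ord_recl derivM IHn big_ord_recl; congr (_ + _).
  by rewrite big_ord_recl eqxx.
rewrite mulr_sumr; apply: eq_bigr => i _.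
rewrite [RHS]big_ord_recl /=; congr (_ * _); apply: eq_bigr => k _.
Qed.

(** Jacobi's formula: differentiating the Leibniz expansion gives a sum of determinants with one row
    differentiated ([B i]); expanding each along that row produces the cofactors. *)
Lemma deriv_det (R : comNzRingType) n (A : 'M[{poly R}]_n) :
  (\det A)^`() = \tr (map_mx (@deriv R) A *m \adj A).
Proof.
pose B i := \matrix_(k, j) (if k == i then (A k j)^`() else A k j).
transitivity (\sum_i \det (B i)).
  rewrite {1}/determinant raddf_sum exchange_big /=; apply: eq_bigr => s _.
  rewrite -mulr_sumr.
  case: (perm.odd_perm s); rewrite ?expr0 ?expr1 ?mul1r ?mulN1r ?derivN deriv_prod;
    [congr (- _)|]; apply: eq_bigr => i _; apply: eq_bigr => k _;
    by rewrite mxE.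
apply: eq_bigr => i _; rewrite (expand_det_row _ i) mxE.
apply: eq_bigr => j _; rewrite !mxE eqxx; congr (_ * _).
rewrite /cofactor; congr (_ * \det _); apply/matrixP => k l.
by rewrite !mxE eq_sym (negPf (neq_lift i k)).
Qed.

(** Both sides equal the determinant of the block matrix with rows [1, - A] and [B, 1], which left
    unitriangular factors clear in two ways. *)
Lemma det_1_mulC (F : comNzRingType) m n (A : 'M[F]_(m, n)) (B : 'M[F]_(n, m)) :
  \det (1%:M + A *m B) = \det (1%:M + B *m A).
Proof.
have dl : \det (block_mx 1%:M (- A) B 1%:M) = \det (1%:M + B *m A).
  have := congr1 determinant
    (mulmx_block 1%:M 0 (- B) 1%:M 1%:M (- A) B (1%:M : 'M[F]_n)).
  rewrite det_mulmx det_lblock !det1 !mul1r.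
  rewrite !mulmx1 !mul0mx !mul1mx !addr0 addNr det_ublock det1 mul1r => ->.
  by rewrite mulmxN mulNmx opprK addrC.
rewrite -dl.
have := congr1 determinant
  (mulmx_block 1%:M A 0 1%:M 1%:M (- A) B (1%:M : 'M[F]_n)).
rewrite det_mulmx det_ublock !det1 !mul1r.
rewrite !mulmx1 !mul0mx !mul1mx !add0r addNr det_lblock det1 mulr1 => ->.
by [].
Qed.

(** Factoring [A] out of [A + B *m D] and applying Sylvester's identity turns a determinant with an
    inverse inside into a quotient. *)
Lemma det_1_mulmx_inv (F : fieldType) m n (A : 'M[F]_m) (B : 'M[F]_(m, n))
    (D : 'M[F]_(n, m)) : A \in unitmx ->
  \det (1%:M + D *m (invmx A *m B)) = \det (A + B *m D) / \det A.
Proof.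
move=> uA; have detA : \det A != 0 by rewrite -unitfE -unitmxE.
rewrite -[A + _](mulKVmx uA) det_mulmx mulmxDr mulVmx // mulrC mulKf //.
by rewrite det_1_mulC mulmxA.
Qed.

Lemma is_derive_unique (R : numFieldType) (V W : normedModType R) (h : V -> W)
    (x v : V) (a b : W) : is_derive x v h a -> is_derive x v h b -> a = b.
Proof. by move=> [_ <-] [_ <-]. Qed.

(** * Conjugate transpose, Frobenius norm and positivity *)

Section ComplexMatrices.
Variable R : realType.
Local Notation C := (R[i]).

HB.instance Definition _ := GRing.RMorphism.copy (@cr R) (real_complex R).

Lemma ReMcr (z : C) (t : R) : complex.Re (z * cr t) = complex.Re z * t.
Proof. by case: z => a b /=; rewrite mulr0 subr0. Qed.

Lemma ReZcr (t : R) (z : C) : complex.Re (cr t * z) = t * complex.Re z.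
Proof. by rewrite mulrC ReMcr mulrC. Qed.

Lemma gt0_cr (z : C) : 0 < z -> z = cr (complex.Re z).
Proof. by case: z => a b; rewrite ltcE /= => /andP[/eqP -> _]. Qed.

Lemma gt0_Re (z : C) : 0 < z -> 0 < complex.Re z.
Proof. by rewrite ltcE => /andP[]. Qed.

Lemma cr_gt0 (t : R) : (0 < cr t :> C) = (0 < t).
Proof. by rewrite ltcE /= eqxx. Qed.

Lemma ctrM m n p (A : 'M[C]_(m, n)) (B : 'M[C]_(n, p)) :
  ctr (A *m B) = ctr B *m ctr A.
Proof. by rewrite /ctr map_mxM trmx_mul. Qed.

Lemma ctrD m n (A B : 'M[C]_(m, n)) : ctr (A + B) = ctr A + ctr B.
Proof. by rewrite /ctr raddfD /= linearD. Qed.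

Lemma ctrZ m n t (A : 'M[C]_(m, n)) : ctr (cr t *: A) = cr t *: ctr A.
Proof.
by apply/matrixP => i j; rewrite !mxE rmorphM /=; congr (_ * _); exact: conjc_real.
Qed.

Lemma ctrK m n (A : 'M[C]_(m, n)) : ctr (ctr A) = A.
Proof. by apply/matrixP => i j; rewrite !mxE; exact: conjcK. Qed.

Lemma ctr1 n : ctr (1%:M : 'M[C]_n) = 1%:M.
Proof. by rewrite /ctr map_mx1 trmx1. Qed.

Lemma ctr_sum m n I (r : seq I) (Q : pred I) (F : I -> 'M[C]_(m, n)) :
  ctr (\sum_(i <- r | Q i) F i) = \sum_(i <- r | Q i) ctr (F i).
Proof. by rewrite /ctr !raddf_sum. Qed.

Lemma ctr_invmx n (A : 'M[C]_n) : ctr (invmx A) = invmx (ctr A).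
Proof. by rewrite /ctr map_invmx trmx_inv. Qed.

Lemma frob2_ge0 m n (A : 'M[C]_(m, n)) : 0 <= frob2 A.
Proof. by do 2!apply: sumr_ge0 => ? _; rewrite addr_ge0 ?sqr_ge0. Qed.

Lemma frob2_eq0 m n (A : 'M[C]_(m, n)) : frob2 A = 0 -> A = 0.
Proof.
move=> /eqP; rewrite psumr_eq0 => [/allP A0|i _]; last first.
  by apply: sumr_ge0 => j _; rewrite addr_ge0 ?sqr_ge0.
apply/matrixP => i j; rewrite mxE.
have := A0 i (mem_index_enum _); rewrite /=.
rewrite psumr_eq0 => [/allP Ai0|k _]; last by rewrite addr_ge0 ?sqr_ge0.
have := Ai0 j (mem_index_enum _); rewrite /= paddr_eq0 ?sqr_ge0 // !sqrf_eq0.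
by case: (A i j) => a b /= /andP[/eqP -> /eqP ->].
Qed.

Lemma frob2_gt0 m n (A : 'M[C]_(m, n)) : A != 0 -> 0 < frob2 A.
Proof.
move=> A0; rewrite lt_neqAle frob2_ge0 andbT eq_sym.
by apply: contra_neq A0; exact: frob2_eq0.
Qed.

Lemma mxtrace_ctr m n (A : 'M[C]_(m, n)) : \tr (A *m ctr A) = cr (frob2 A).
Proof.
rewrite /frob2 rmorph_sum; apply: eq_bigr => i _.
rewrite mxE rmorph_sum; apply: eq_bigr => j _; rewrite !mxE.
case: (A i j) => a b; apply/eqP; rewrite eq_complex /=.
by apply/andP; split; apply/eqP; ring.
Qed.

(** The determinant is the product of the roots of the characteristic polynomial; at a left
    eigenvector the form is the eigenvalue times a positive squared norm. Over [C], [0 < z] includes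
    that [z] is real. *)
Lemma posdef_det_gt0 n (A : 'M[C]_n) :
  (forall v : 'rV_n, v != 0 -> 0 < \tr (v *m A *m ctr v)) -> 0 < \det A.
Proof.
move=> Apos; have [r Er] := closed_field_poly_normal (char_poly A).
have lA : lead_coef (char_poly A) = 1 by apply/monicP; exact: char_poly_monic.
have sr : size r = n.
  apply: succn_inj; rewrite -(size_char_poly A) Er lA scale1r.
  by rewrite size_prod_XsubC.
have -> : \det A = \prod_(z <- r) z.
  have := char_poly_det A; rewrite Er lA scale1r -horner_coef0 horner_prod.
  under eq_bigr do rewrite hornerXsubC sub0r -mulN1r.
  rewrite big_split /= big_const_seq count_predT sr iter_mulr mulr1.
  by move=> /(mulfI (negbT (signr_eq0 _ _))) ->.
rewrite big_seq; apply: prodr_gt0 => z zr.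
have : eigenvalue A z by rewrite eigenvalue_root_char Er lA scale1r root_prod_XsubC.
move=> /eigenvalueP[v vA v0]; have := Apos v v0.
rewrite vA -scalemxAl mxtraceZ mxtrace_ctr.
by rewrite pmulr_lgt0 // cr_gt0 frob2_gt0.
Qed.


(** * Covariance matrices of received signals *)

Definition cov n m (I : finType) (s : R) (Q : pred I) (X : I -> 'M[C]_(n, m)) :
  'M[C]_n := cr s *: 1%:M + \sum_(j | Q j) X j *m ctr (X j).

(** Linear coefficient of the signal part of [cov] when [X] moves in the direction [Y]. *)
Definition cross n m (I : finType) (Q : pred I) (X Y : I -> 'M[C]_(n, m)) :
  'M[C]_n := \sum_(j | Q j) (X j *m ctr (Y j) + Y j *m ctr (X j)).

Section Covariance.
Variables (n m : nat) (I : finType).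
Implicit Types (s t : R) (Q : pred I) (X Y : I -> 'M[C]_(n, m)).

Lemma cov_form s Q X p (Z : 'M[C]_(p, n)) :
  \tr (Z *m cov s Q X *m ctr Z) =
  cr (s * frob2 Z + \sum_(j | Q j) frob2 (Z *m X j)).
Proof.
rewrite /cov mulmxDr mulmxDl linearD /= -scalemxAr mulmx1 -scalemxAl mxtraceZ.
rewrite mxtrace_ctr rmorphD rmorphM /=; congr (_ + _).
rewrite mulmx_sumr mulmx_suml !raddf_sum /=; apply: eq_bigr => j _.
by rewrite -mxtrace_ctr ctrM !mulmxA.
Qed.

Lemma cov_form_gt0 s Q X p (Z : 'M[C]_(p, n)) :
  0 < s -> Z != 0 -> 0 < \tr (Z *m cov s Q X *m ctr Z).
Proof.
move=> s0 Z0; rewrite cov_form cr_gt0 ltr_pwDl ?mulr_gt0 ?frob2_gt0 //.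
by apply: sumr_ge0 => j _; exact: frob2_ge0.
Qed.

Lemma cov_det_gt0 s Q X : 0 < s -> 0 < \det (cov s Q X).
Proof. by move=> s0; apply: posdef_det_gt0 => v; exact: cov_form_gt0. Qed.

Lemma cov_unitmx s Q X : 0 < s -> cov s Q X \in unitmx.
Proof. by move=> s0; rewrite unitmxE unitfE gt_eqF // cov_det_gt0. Qed.

Lemma ctr_cov s Q X : ctr (cov s Q X) = cov s Q X.
Proof.
rewrite /cov ctrD ctrZ ctr1 ctr_sum; congr (_ + _).
by apply: eq_bigr => j _; rewrite ctrM ctrK.
Qed.

Lemma covD1 s X k : cov s xpredT X = cov s (predC1 k) X + X k *m ctr (X k).
Proof. by rewrite /cov (bigD1 k) //= [X k *m _ + _]addrC addrA. Qed.

Lemma covZ s t Q X :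
  cov (t ^+ 2 * s) Q (fun j => cr t *: X j) = cr (t ^+ 2) *: cov s Q X.
Proof.
rewrite /cov scalerDr scalerA -rmorphM scaler_sumr; congr (_ + _).
apply: eq_bigr => j _.
by rewrite ctrZ -scalemxAl -scalemxAr scalerA -rmorphM.
Qed.

(** The noise level is allowed to move quadratically, as the total power does along a line: this
    serves [g], and [l = q = 0] serves [f]. *)
Lemma cov_line s l q t Q X Y :
  cov (s + l * t + q * t ^+ 2) Q (fun j => X j + cr t *: Y j) =
  cov s Q X + cr t *: (cr l *: 1%:M + cross Q X Y)
  + cr (t ^+ 2) *: cov q Q Y.
Proof.
rewrite /cov.
have -> : \sum_(j | Q j) (X j + cr t *: Y j) *m ctr (X j + cr t *: Y j) =
  \sum_(j | Q j) X j *m ctr (X j) + cr t *: cross Q X Y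
  + cr (t ^+ 2) *: \sum_(j | Q j) Y j *m ctr (Y j).
  rewrite /cross !scaler_sumr -!big_split; apply: eq_bigr => j _ /=.
  rewrite ctrD ctrZ mulmxDl !mulmxDr -!scalemxAl -!scalemxAr scalerA.
  by rewrite -rmorphM -expr2 scalerDr !addrA.
rewrite !rmorphD !rmorphM /= !scalerDl !scalerDr !scalerA.
rewrite [cr l * _]mulrC [cr q * _]mulrC !addrA.
by rewrite [LHS](ACl (1*4*2*5*3*6)).
Qed.

(* With B = F + Y Y^H,
   F^-1 - B^-1 = (B^-1 Y) (B^-1 Y)^H + Z F Z^H  for  Z = B^-1 Y Y^H F^-1. *)
Lemma mxtrace_invmx_cov_le s X k : 0 < s ->
  complex.Re (\tr (invmx (cov s xpredT X))) <=
  complex.Re (\tr (invmx (cov s (predC1 k) X))).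
Proof.
move=> s0.
have [uB uF] := (cov_unitmx xpredT X s0, cov_unitmx (predC1 k) X s0).
have [cB cF] := (ctr_cov s xpredT X, ctr_cov s (predC1 k) X).
have BE := covD1 s X k; have Fform p := @cov_form s (predC1 k) X p.
move: (cov s xpredT X) (cov s (predC1 k) X) => B F in uB uF cB cF BE Fform *.
set Y := X k in BE; set Z := invmx B *m Y *m ctr Y *m invmx F.
suff -> : invmx F = invmx B + (invmx B *m Y) *m ctr (invmx B *m Y)
    + Z *m F *m ctr Z.
  rewrite !mxtraceD mxtrace_ctr Fform !raddfD /= -addrA lerDl.
  apply: addr_ge0; first exact: frob2_ge0.
  apply: addr_ge0; first by rewrite mulr_ge0 ?frob2_ge0 // ltW.
  by apply: sumr_ge0 => j _; exact: frob2_ge0.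
(* Conjugating by [B] reduces the claim to expanding [B *m invmx F *m B] with B = F + Y Y^H. *)
have -> : invmx F = invmx B *m (B *m invmx F *m B) *m invmx B.
  by rewrite !mulmxA mulVmx // mul1mx -mulmxA mulmxV // mulmx1.
have -> : B *m invmx F *m B = B + Y *m ctr Y + Y *m ctr Y *m invmx F *m Y *m ctr Y.
  rewrite {1 2}BE mulmxDl mulmxV // mulmxDl mul1mx mulmxDr -!mulmxA mulVmx //.
  by rewrite mulmx1 !mulmxA !addrA BE.
rewrite /Z !ctrM !ctr_invmx cB cF ctrK !mulmxDr !mulmxDl.
congr (_ + _ + _); first by rewrite (mulVmx uB) mul1mx.
  by rewrite !mulmxA.
by rewrite !mulmxA (mulmxKV uF).
Qed.

End Covariance.

(** * Log-determinants along curves *)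

Lemma logdet_curve n (A0 A1 A2 : 'M[C]_n) : 0 < \det A0 ->
  is_derive (0 : R) (1 : R)
    (fun t => logdet (A0 + cr t *: A1 + cr (t ^+ 2) *: A2))
    (complex.Re (\tr (invmx A0 *m A1))).
Proof.
move=> A0pos.
(* The curve is lifted to a matrix of polynomials. Since [t] is real, taking real parts of the
   coefficients of its determinant gives a real polynomial [p] with the values needed, and Jacobi's
   formula yields its derivative at 0. *)
pose A := map_mx polyC A0 + 'X *: map_mx polyC A1 + 'X^2 *: map_mx polyC A2.
pose p := map_poly (@complex.Re R) (\det A).
have AE (x : C) : map_mx (horner_eval x) A = A0 + x *: A1 + x ^+ 2 *: A2.
  by apply/matrixP => i j; rewrite !mxE /horner_eval !hornerE.
have pE t : complex.Re (\det (A0 + cr t *: A1 + cr (t ^+ 2) *: A2)) = p.[t].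
  rewrite rmorphXn /= -AE det_map_mx /= /horner_eval.
  rewrite (horner_coef (\det A)) (@horner_coef_wide _ (size (\det A)) p) ?size_poly //.
  rewrite raddf_sum; apply: eq_bigr => i _.
  by rewrite -rmorphXn /= ReMcr coef_map.
have p0 : p.[0] = complex.Re (\det A0).
  by rewrite -pE expr0n /= !rmorph0 !scale0r !addr0.
have dA : (\det A)^`().[0] = \tr (A1 *m \adj A0).
  rewrite deriv_det -[LHS]/(horner_eval 0 _) -trace_map_mx map_mxM.
  rewrite map_mx_adj AE expr0n /= !scale0r !addr0.
  congr (\tr (_ *m _)); apply/matrixP => i j.
  rewrite !mxE /horner_eval horner_coef0 coef_deriv mulr1n !coefD.
  by rewrite coefXM coefXnM !coefC add0r addr0.
have p1 : p^`().[0] = complex.Re (\tr (A1 *m \adj A0)).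
  by rewrite -dA !horner_coef0 !coef_deriv !mulr1n coef_map.
have uA : A0 \in unitmx by rewrite unitmxE unitfE gt_eqF.
have -> : (fun t => logdet (A0 + cr t *: A1 + cr (t ^+ 2) *: A2)) =
    @ln R \o horner p.
  by apply/funext => t; rewrite /logdet pE.
have p0pos : 0 < p.[0] by rewrite p0 gt0_Re.
apply: is_derive_eq; first exact: (is_derive1_comp (is_derive1_ln p0pos)).
(* The determinant of [A0] is real, so its inverse can be moved out of the real part. *)
rewrite p0 p1 /invmx uA -scalemxAl mxtraceZ mxtrace_mulC.
by rewrite [in RHS](gt0_cr A0pos) -fmorphV ReZcr.
Qed.

Lemma logdetZ n (t : R) (A : 'M[C]_n) : 0 < t -> 0 < \det A ->
  logdet (cr t *: A) = ln (t ^+ n) + logdet A.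
Proof.
move=> t0 A0; rewrite /logdet detZ -rmorphXn /= ReZcr lnM ?posrE ?exprn_gt0 //.
exact: gt0_Re.
Qed.

(** With [F] the noise plus interference of user [k] and B = F + X_k X_k^H the full covariance, the
    rate is log |B| - log |F|. *)
Lemma logdet_sinr N M d (I : finType) (s : R) (H : 'M[C]_(N, M))
    (V : I -> 'M[C]_(M, d)) k : 0 < s ->
  logdet (1%:M + ctr (V k) *m ctr H *m
      invmx (cr s *: 1%:M + \sum_(j | j != k) H *m V j *m ctr (V j) *m ctr H)
      *m H *m V k) =
  logdet (cov s xpredT (fun j => H *m V j))
  - logdet (cov s (predC1 k) (fun j => H *m V j)).
Proof.
move=> s0; pose X j := H *m V j.
have -> : cr s *: 1%:M + \sum_(j | j != k) H *m V j *m ctr (V j) *m ctr H =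
    cov s (predC1 k) X.
  by congr (_ + _); apply: eq_bigr => j _; rewrite /X ctrM !mulmxA.
rewrite -!mulmxA -/(X k) [ctr (V k) *m _]mulmxA -ctrM -/(X k).
set F := cov s (predC1 k) X; set B := cov s xpredT X.
have [F0 B0] : 0 < \det F /\ 0 < \det B by split; exact: cov_det_gt0.
have uF : F \in unitmx by exact: cov_unitmx.
rewrite /logdet det_1_mulmx_inv // -covD1 -/F -/B.
rewrite (gt0_cr B0) (gt0_cr F0) -fmorphV -rmorphM /=.
by rewrite ln_div ?posrE ?gt0_Re.
Qed.

Lemma is_derive_quadratic (s l q : R) :
  is_derive (0 : R) (1 : R) (fun t : R => s + l * t + q * t ^+ 2) l.
Proof.
pose p : {poly R} := s%:P + l%:P * 'X + q%:P * 'X^2.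
have -> : (fun t : R => s + l * t + q * t ^+ 2) = horner p.
  by apply/funext => t; rewrite /p !hornerE.
apply: is_derive_eq.
rewrite horner_coef0 coef_deriv mulr1n !coefD coefCM coefX coefCM coefXn coefC /=.
by rewrite mulr1 mulr0 add0r addr0.
Qed.

Lemma near_quadratic_gt0 (s l q : R) : 0 < s ->
  \forall t \near (0 : R), 0 < s + l * t + q * t ^+ 2.
Proof.
move=> s0; have [df _] := is_derive_quadratic s l q.
have cf : {for 0, continuous (fun t : R => s + l * t + q * t ^+ 2)}.
  by apply/differentiable_continuous/derivable1_diffP.
by apply: (cvgr_gt _ cf); rewrite mulr0 expr0n /= mulr0 !addr0.
Qed.

(** * The rate as a function of noise level and beamformers *)

Section WeightedSumRate.
Variables (K M N d : nat) (w : 'I_K -> R) (H : 'I_K -> 'M[C]_(N, M)).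
Implicit Types (V W : 'I_K -> 'M[C]_(M, d)) (s t : R).

Let rx V k : 'I_K -> 'M[C]_(N, d) := fun j => H k *m V j.

Let rx_vline V W t k : rx (vline V W t) k = fun j => rx V k j + cr t *: rx W k j.
Proof. by apply/funext => j; rewrite /rx mulmxDr -scalemxAr. Qed.

Let rx_vscale V t k : rx (vscale t V) k = fun j => cr t *: rx V k j.
Proof. by apply/funext => j; rewrite /rx -scalemxAr. Qed.

Lemma wsrE s V : 0 < s ->
  wsr w H s V = \sum_(k < K) w k *
    (logdet (cov s xpredT (rx V k)) - logdet (cov s (predC1 k) (rx V k))).
Proof. by move=> s0; apply: eq_bigr => k _; rewrite logdet_sinr. Qed.

(** Both covariances of a user gain the same factor [t ^+ 2], whose logarithms cancel in the
    difference. *)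
Lemma wsr_scale s t V : 0 < s -> 0 < t ->
  wsr w H (t ^+ 2 * s) (vscale t V) = wsr w H s V.
Proof.
move=> s0 t0; have t20 : 0 < t ^+ 2 by rewrite exprn_gt0.
rewrite (wsrE _ (mulr_gt0 t20 s0)) (wsrE _ s0); apply: eq_bigr => k _.
rewrite rx_vscale !covZ (logdetZ t20 (cov_det_gt0 xpredT _ s0)).
rewrite (logdetZ t20 (cov_det_gt0 (predC1 k) _ s0)).
by rewrite opprD addrACA subrr add0r.
Qed.

(* The partial derivatives of [wsr w H] in the noise level and in the
   beamformers; [wsr_curve] is the chain rule that makes them so. *)
Definition wsr_dnoise s V : R := \sum_(k < K) w k *
  (complex.Re (\tr (invmx (cov s xpredT (rx V k))))
   - complex.Re (\tr (invmx (cov s (predC1 k) (rx V k))))).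

Definition wsr_dbeam s V W : R := \sum_(k < K) w k *
  (complex.Re (\tr (invmx (cov s xpredT (rx V k))
                    *m cross xpredT (rx V k) (rx W k)))
   - complex.Re (\tr (invmx (cov s (predC1 k) (rx V k))
                      *m cross (predC1 k) (rx V k) (rx W k)))).

Lemma wsr_dnoise_le0 s V : (forall k, 0 <= w k) -> 0 < s -> wsr_dnoise s V <= 0.
Proof.
move=> w0 s0; rewrite -oppr_ge0 -sumrN; apply: sumr_ge0 => k _.
by rewrite -mulrN opprB mulr_ge0 // subr_ge0 mxtrace_invmx_cov_le.
Qed.

Lemma wsr_curve s l q V W : 0 < s ->
  is_derive (0 : R) (1 : R)
    (fun t => wsr w H (s + l * t + q * t ^+ 2) (vline V W t))
    (wsr_dbeam s V W + l * wsr_dnoise s V).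
Proof.
move=> s0.
pose term Q k t := logdet (cov s Q (rx V k)
  + cr t *: (cr l *: 1%:M + cross Q (rx V k) (rx W k))
  + cr (t ^+ 2) *: cov q Q (rx W k)).
have dterm Q k : is_derive (0 : R) (1 : R) (term Q k)
    (complex.Re (\tr (invmx (cov s Q (rx V k)) *m cross Q (rx V k) (rx W k)))
     + l * complex.Re (\tr (invmx (cov s Q (rx V k))))).
  apply: is_derive_eq; first by apply: logdet_curve; exact: cov_det_gt0.
  rewrite mulmxDr linearD raddfD addrC /=; congr (_ + _).
  by rewrite -scalemxAr mulmx1 mxtraceZ ReZcr.
(* The covariance form of the rate requires positive noise, which is only guaranteed for [t] near
   0. *)
apply: (@near_eq_is_derive _ _ _
    (\sum_(k < K) (w k *: (term xpredT k - term (predC1 k) k)))).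
  near=> t; rewrite wsrE; last first.
    by near: t; exact: near_quadratic_gt0.
  rewrite fct_sumE; apply: eq_bigr => k _.
  by rewrite rx_vline !cov_line.
apply: is_derive_eq.
rewrite /wsr_dbeam /wsr_dnoise mulr_sumr -big_split; apply: eq_bigr => k _ /=.
rewrite /GRing.scale /=; ring.
Unshelve. all: by end_near. Qed.

(* Euler's identity for the degree-0 homogeneity [wsr_scale], obtained by
   differentiating t |-> wsr w H ((1 + t)^2 s) ((1 + t) V) at 0. *)
Lemma wsr_dbeam_self s V : 0 < s ->
  wsr_dbeam s V V = - (2 * s * wsr_dnoise s V).
Proof.
move=> s0; have dV := wsr_curve (2 * s) s V V s0.
have : is_derive (0 : R) (1 : R)
    (fun t => wsr w H (s + 2 * s * t + s * t ^+ 2) (vline V V t)) 0.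
  apply: (@near_eq_is_derive _ _ _ (cst (wsr w H s V))).
  near=> t.
  have t0 : 0 < 1 + t.
    near: t. have := @near_quadratic_gt0 1 1 0 ltr01.
    by apply: filterS => t; rewrite mul1r mul0r addr0.
  have -> : vline V V t = vscale (1 + t) V.
    by apply/funext => k; rewrite /vscale /vline rmorphD rmorph1 scalerDl scale1r.
  have -> : s + 2 * s * t + s * t ^+ 2 = (1 + t) ^+ 2 * s by ring.
  by apply/esym; exact: wsr_scale.
by move=> /(is_derive_unique dV)/eqP; rewrite addr_eq0 => /eqP.
Unshelve. all: by end_near. Qed.

End WeightedSumRate.

(** * Total power along lines and under scaling *)

Lemma frob2Z m n t (A : 'M[C]_(m, n)) : frob2 (cr t *: A) = t ^+ 2 * frob2 A.
Proof.
rewrite /frob2 mulr_sumr; apply: eq_bigr => i _.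
rewrite mulr_sumr; apply: eq_bigr => j _; rewrite mxE.
by case: (A i j) => a b /=; ring.
Qed.

Section TotalPower.
Variables (K M d : nat).
Implicit Types (V W : 'I_K -> 'M[C]_(M, d)).

Definition totpow_dir V W : R := \sum_(k < K) \sum_i \sum_j
  2 * (complex.Re (V k i j) * complex.Re (W k i j)
       + complex.Im (V k i j) * complex.Im (W k i j)).

Lemma totpow_scale t V : totpow (vscale t V) = t ^+ 2 * totpow V.
Proof. by rewrite /totpow mulr_sumr; apply: eq_bigr => k _; exact: frob2Z. Qed.

Lemma totpow_line V W t :
  totpow (vline V W t) = totpow V + totpow_dir V W * t + totpow W * t ^+ 2.
Proof.
rewrite /totpow /totpow_dir !mulr_suml -!big_split; apply: eq_bigr => k _ /=.
rewrite /frob2 !mulr_suml -!big_split; apply: eq_bigr => i _ /=.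
rewrite !mulr_suml -!big_split; apply: eq_bigr => j _ /=.
rewrite !mxE; case: (V k i j) => a b; case: (W k i j) => a' b' /=; ring.
Qed.

Lemma totpow_dir_self V : totpow_dir V V = 2 * totpow V.
Proof.
rewrite /totpow mulr_sumr; apply: eq_bigr => k _.
rewrite /frob2 mulr_sumr; apply: eq_bigr => i _.
by rewrite mulr_sumr; apply: eq_bigr => j _; rewrite -!expr2.
Qed.

(** Transfers lines through the scaled point back to lines through [V], at the cost of rescaling the
    direction. *)
Lemma vline_scale V W (t r : R) : r != 0 ->
  vline (vscale r V) W t = vscale r (vline V (vscale r^-1 W) t).
Proof.
move=> r0; have rt : r * t * r^-1 = t by rewrite mulrAC mulfV // mul1r.
apply/funext => k; rewrite /vline /vscale scalerDr !scalerA.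
by rewrite -!(rmorphM (@cr R)) rt.
Qed.

Lemma vscaleK V (r : R) : r != 0 -> vscale r^-1 (vscale r V) = V.
Proof.
move=> r0; apply/funext => k.
by rewrite /vscale scalerA -rmorphM mulVf // rmorph1 scale1r.
Qed.

End TotalPower.

End ComplexMatrices.

(** * Directional derivatives of the objectives and of the constraint *)

Section Gradients.
Variables (R : realType) (K M N d : nat) (sigma2 P : R).
Hypotheses (sigma0 : 0 < sigma2) (P0 : 0 < P).
Variables (w : 'I_K -> R) (H : 'I_K -> 'M[R[i]]_(N, M)).
Implicit Types V W : 'I_K -> 'M[R[i]]_(M, d).

Lemma gobj_dirder V W : 0 < totpow V ->
  let s := sigma2 / P * totpow V in
  dirder (gobj sigma2 P w H) V W
    (wsr_dbeam w H s V W + sigma2 / P * totpow_dir V W * wsr_dnoise w H s V).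
Proof.
move=> V0 s; have s0 : 0 < s by rewrite mulr_gt0 ?divr_gt0.
rewrite /dirder.
have -> : (fun t : R => gobj sigma2 P w H (vline V W t)) =
    fun t => wsr w H (s + sigma2 / P * totpow_dir V W * t
                      + sigma2 / P * totpow W * t ^+ 2) (vline V W t).
  apply/funext => t; rewrite /gobj totpow_line !mulrDr.
  by rewrite -/s !mulrA.
exact: wsr_curve.
Qed.

(** Scale invariance replaces noise [sigma2] near the scaled point by the constant noise [s] near
    [V], so no noise derivative appears. *)
Lemma fobj_dirder_scale V W r s : 0 < r -> 0 < s -> r ^+ 2 * s = sigma2 ->
  dirder (fobj sigma2 w H) (vscale r V) W (wsr_dbeam w H s V (vscale r^-1 W)).
Proof.
move=> r0 s0 rs; rewrite /dirder.
have -> : (fun t : R => fobj sigma2 w H (vline (vscale r V) W t)) =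
    fun t => wsr w H (s + 0 * t + 0 * t ^+ 2) (vline V (vscale r^-1 W) t).
  apply/funext => t; rewrite (vline_scale _ _ _ (lt0r_neq0 r0)) /fobj -rs.
  by rewrite (wsr_scale w H _ s0 r0) !mul0r !addr0.
have := wsr_curve w H 0 0 V (vscale r^-1 W) s0.
by rewrite mul0r addr0.
Qed.

Lemma powcon_dirder_scale V W r : 0 < r ->
  dirder (powcon P) (vscale r V) W (r ^+ 2 * totpow_dir V (vscale r^-1 W)).
Proof.
move=> r0; rewrite /dirder; set W' := vscale r^-1 W.
have -> : (fun t : R => powcon P (vline (vscale r V) W t)) =
    fun t => (r ^+ 2 * totpow V - P) + r ^+ 2 * totpow_dir V W' * t
             + r ^+ 2 * totpow W' * t ^+ 2.
  apply/funext => t; rewrite (vline_scale _ _ _ (lt0r_neq0 r0)) /powcon.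
  rewrite totpow_scale.
  by rewrite totpow_line -/W'; ring.
exact: is_derive_quadratic.
Qed.

End Gradients.

Theorem theorem1 (R : realType) (K M N d : nat)
  (hK : (0 < K)%N) (hM : (0 < M)%N) (hN : (0 < N)%N) (hd : (0 < d)%N)
  (sigma2 P : R) (hsigma : 0 < sigma2) (hP : 0 < P)
  (w : 'I_K -> R) (hw : forall k, 0 < w k)
  (H : 'I_K -> 'M[R[i]]_(N, M))
  (V : 'I_K -> 'M[R[i]]_(M, d)) (hV : 0 < totpow V) :
  stationary (gobj sigma2 P w H) V <->
  kkt_point (fobj sigma2 w H) (powcon P)
    (vscale (Num.sqrt (P / totpow V)) V).
Proof.
set T := totpow V in hV *; set r := Num.sqrt (P / T).
have r0 : 0 < r by rewrite sqrtr_gt0 divr_gt0.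
have r2 : r ^+ 2 = P / T by rewrite sqr_sqrtr // ltW // divr_gt0.
pose s := sigma2 / P * T; have s0 : 0 < s by rewrite !mulr_gt0 ?invr_gt0.
(* The scaling [r] carries the noise level of [g] at [V] to that of [f]. *)
have rs : r ^+ 2 * s = sigma2 by rewrite r2 /s; field; rewrite !gt_eqF.
pose D := wsr_dnoise w H s V.
have D0 : D <= 0 by apply: wsr_dnoise_le0 => // k; exact: ltW.
have dg W := gobj_dirder hsigma hP w H W hV.
have df W := fobj_dirder_scale w H V W r0 s0 rs.
have dc W := powcon_dirder_scale P V W r0.
(* The constraint is tight here, which settles feasibility and complementary slackness. *)
have active : powcon P (vscale r V) = 0.
  by rewrite /powcon totpow_scale r2 -/T divfK ?subrr ?gt_eqF.
split=> [gstat|[_ [mu [_ [_ kkt]]]] W].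
- split; first by rewrite active.
  exists (- (s / P * D)); rewrite active mulr0; split; last split => // W.
    by rewrite -mulrN mulr_ge0 ?oppr_ge0 // ltW // divr_gt0.
  exists (wsr_dbeam w H s V (vscale r^-1 W)).
  exists (r ^+ 2 * totpow_dir V (vscale r^-1 W)).
  split; first exact: df.
  split; first exact: dc.
  have := is_derive_unique (dg (vscale r^-1 W)) (gstat (vscale r^-1 W)).
  rewrite -/T -/s -/D => /eqP; rewrite addr_eq0 => /eqP ->.
  by rewrite -rs; field; rewrite gt_eqF.
(* Using the direction [vscale r W'] undoes the rescaling, so the KKT equation is read at [V] for
   every [W']. *)
have kktE W' : wsr_dbeam w H s V W' = mu * (r ^+ 2 * totpow_dir V W').
  have [dh [dk [dfh [dck dhE]]]] := kkt (vscale r W').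
  have Wr : vscale r^-1 (vscale r W') = W' by rewrite vscaleK ?gt_eqF.
  have := is_derive_unique (df (vscale r W')) dfh; rewrite Wr dhE => ->.
  by rewrite -(is_derive_unique (dc (vscale r W')) dck) Wr.
(* At W' = V the KKT equation reads - 2 s D = 2 P mu. *)
have muE : mu = - (s * D / P).
  have := kktE V; rewrite wsr_dbeam_self // totpow_dir_self -/T -/D r2 => E.
  apply: (mulfI (_ : 2 * P != 0)); first by rewrite mulf_neq0 ?gt_eqF.
  transitivity (mu * (P / T * (2 * T))); first by field; rewrite gt_eqF.
  by rewrite -E; field; rewrite gt_eqF.
apply: is_derive_eq; first exact: dg.
(* Now mu r^2 = - (sigma^2 / P) D, so the beamformer term cancels the noise term. *)
rewrite -/T -/s -/D kktE muE r2 /s; field.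
by rewrite !gt_eqF.
Qed.
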